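(* Let $H$ be a finite-dimensional Hopf algebra over a field $\mathbb{F}$ whose group $G=G(H)$ of group-like elements is abelian, let $\widehat{G}=\mathrm{Hom}(G,\mathbb{F}^\times)$, and assume $|\widehat{G}|=|G|$. Let $H$ act on a unital $\mathbb{F}$-algebra $A$, and let $$\Gamma:\ A=\bigoplus_{\varphi\in\widehat{G}}A_\varphi,\qquad A_\varphi=\{a\in A : g* a=\varphi(g)a\ \text{for all } g\in G\},$$ be the associated $\widehat{G}$-grading. Suppose $x\in H$ and $\chi\in\widehat{G}$ satisfy $hx=\chi(h)xh$ for all $h\in G$. Let $K$ be the kernel of the action of $G$ on $A$, let $K^\perp=\{\varphi\in\widehat{G}:\varphi(k)=1\ \text{for all }k\in K\}$, and let $T$ be the subgroup of $\widehat{G}$ generated by $\mathrm{Supp}\,\Gamma=\{\varphi\in\widehat{G}: A_\varphi\neq 0\}$. Then: (i) for every $\gamma\in\widehat{G}$, the action of $x$ maps $A_\gamma$ into $A_{\chi\gamma}$; (ii) if $\chi\notin K^\perp$, then $x$ acts trivially on $A$; (iii) if $\chi\notin T$, then $x$ acts trivially on $A$; (iv) if there is a natural number $m$ such that $\varphi^m=\varepsilon$ for all $\varphi\in\mathrm{Supp}\,\Gamma$ and $\chi^m\neq\varepsilon$, then $x$ acts trivially on $A$.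
   Context: An action of a Hopf algebra $H$ on a unital algebra $A$ is a unital left $H$-module structure $(h,a)\mapsto h*a$ with $h*1=\varepsilon(h)1$ and $h*(ab)=\sum(h_{(1)}*a)(h_{(2)}*b)$ (that is, $A$ is an $H$-module algebra). The element $x$ acts trivially on $A$ means $x*a=0$ for all $a\in A$. In (iv), $\varepsilon\in\widehat{G}$ denotes the trivial character. *)

(* Defs.v *)
From HB Require Import structures.
From mathcomp Require Import all_boot all_algebra all_field.
From mathcomp Require Import all_classical.

Set Implicit Arguments.
Unset Strict Implicit.
Unset Printing Implicit Defensive.

Import GRing.Theory.
Local Open Scope classical_set_scope.
Local Open Scope ring_scope.

(** [tensor U V] is modelled by matrices of coordinates with respect to
    [vbasis {:U}] and [vbasis {:V}].  The lemmas [tlift_tens] and [tlift_uniq]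
    are its universal property, which determines it up to isomorphism
    independently of those bases. *)

Definition tensor (F : fieldType) (U V : vectType F) : Type :=
  'M[F]_(\dim {:U}, \dim {:V}).

HB.instance Definition _ (F : fieldType) (U V : vectType F) :=
  Vector.copy (tensor U V) 'M[F]_(\dim {:U}, \dim {:V}).

Section Tensor.
Variables (F : fieldType) (U V : vectType F).

Definition tens (u : U) (v : V) : tensor U V :=
  \matrix_(i, j) (coord (vbasis {:U}) i u * coord (vbasis {:V}) j v).

(* The linear map on [tensor U V] induced by a bilinear [b]; it sends
   [\sum_k tens (u k) (v k)] to [\sum_k b (u k) (v k)]. *)
Definition tlift (W : lmodType F) (b : U -> V -> W) (t : tensor U V) : W :=
  \sum_i \sum_j
    (t : 'M[F]_(_, _)) i j *: b (vbasis {:U})`_i (vbasis {:V})`_j.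

Definition bilin (W : lmodType F) (b : U -> V -> W) : Prop :=
  (forall u, linear (b u)) /\ (forall v, linear (b^~ v)).

Lemma tlift_is_linear (W : lmodType F) (b : U -> V -> W) : linear (tlift b).
Proof.
move=> a s t; rewrite /tlift scaler_sumr -big_split; apply: eq_bigr => i _ /=.
rewrite scaler_sumr -big_split; apply: eq_bigr => j _ /=.
by rewrite !mxE scalerDl scalerA.
Qed.

HB.instance Definition _ (W : lmodType F) (b : U -> V -> W) :=
  GRing.isLinear.Build F (tensor U V) W _ (tlift b) (tlift_is_linear b).

Lemma tens_bilin : bilin tens.
Proof.
split=> w a s t; apply/matrixP=> i j; rewrite !mxE linearP /=.
  by rewrite mulrDr mulrCA.
by rewrite mulrDl mulrA.
Qed.

Lemma bilin_suml (W : lmodType F) (b : U -> V -> W) : bilin b ->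
  forall (I : finType) (c : I -> F) (f : I -> U) v,
    b (\sum_i c i *: f i) v = \sum_i c i *: b (f i) v.
Proof.
move=> [_ b2] I c f v.
pose g := GRing.isLinear.Build F U W _ (b^~ v) (b2 v).
pose h : {linear U -> W} := HB.pack (b^~ v) g.
by rewrite -[LHS]/(h _) linear_sum; apply: eq_bigr => i _; rewrite linearZ.
Qed.

Lemma bilin_sumr (W : lmodType F) (b : U -> V -> W) : bilin b ->
  forall (I : finType) (c : I -> F) u (f : I -> V),
    b u (\sum_i c i *: f i) = \sum_i c i *: b u (f i).
Proof.
move=> [b1 _] I c u f.
pose g := GRing.isLinear.Build F V W _ (b u) (b1 u).
pose h : {linear V -> W} := HB.pack (b u) g.
by rewrite -[LHS]/(h _) linear_sum; apply: eq_bigr => i _; rewrite linearZ.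
Qed.

Lemma tlift_tens (W : lmodType F) (b : U -> V -> W) : bilin b ->
  forall u v, tlift b (tens u v) = b u v.
Proof.
move=> bb u v.
rewrite {2}(coord_vbasis (memvf u)) {2}(coord_vbasis (memvf v)).
rewrite (bilin_suml bb); apply: eq_bigr => i _.
rewrite (bilin_sumr bb) scaler_sumr; apply: eq_bigr => j _.
by rewrite mxE scalerA.
Qed.

Lemma tens_basis (t : tensor U V) :
  t = \sum_i \sum_j
        (t : 'M[F]_(_, _)) i j *: tens (vbasis {:U})`_i (vbasis {:V})`_j.
Proof.
have tE (i : 'I_(\dim {:U})) (j : 'I_(\dim {:V})) :
      tens (vbasis {:U})`_i (vbasis {:V})`_j = delta_mx i j :> 'M[F]_(_, _).
  apply/matrixP=> k l; rewrite !mxE !coord_free ?(basis_free (vbasisP _)) //.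
  by rewrite -natrM mulnb -!val_eqE ![val k == _]eq_sym ![val l == _]eq_sym.
rewrite [LHS](matrix_sum_delta t); apply: eq_bigr => i _.
by apply: eq_bigr => j _; rewrite tE.
Qed.

Lemma tlift_uniq (W : lmodType F) (b : U -> V -> W)
    (f : {linear tensor U V -> W}) :
  (forall u v, f (tens u v) = b u v) -> f =1 tlift b.
Proof.
move=> fE t; rewrite {1}[t]tens_basis linear_sum; apply: eq_bigr => i _.
by rewrite linear_sum; apply: eq_bigr => j _; rewrite linearZ fE.
Qed.

End Tensor.

(* (a (x) b) (c (x) d) = ac (x) bd *)
Definition tmul (F : fieldType) (A : falgType F) (s t : tensor A A) :
    tensor A A :=
  tlift (fun a b => tlift (fun c d => tens (a * c) (b * d)) t) s.

HB.mixin Record isHopf (F : fieldType) H of Falgebra F H := {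
  comul : H -> tensor H H;
  counit : H -> F;
  antipode : H -> H;
  comul_is_linear : linear comul;
  counit_is_scalar : scalar counit;
  antipode_is_linear : linear antipode;
  (* (comul (x) id) o comul = (id (x) comul) o comul, with
     (H (x) H) (x) H identified with H (x) (H (x) H) *)
  comulA : forall h,
    tlift (fun x y => tlift (fun p q => tens p (tens q y)) (comul x)) (comul h)
    = tlift (fun x y => tens x (comul y)) (comul h);
  counitl : forall h, tlift (fun x y => counit x *: y) (comul h) = h;
  counitr : forall h, tlift (fun x y => counit y *: x) (comul h) = h;
  comul1 : comul 1 = tens 1 1;
  comulM : forall g h, comul (g * h) = tmul (comul g) (comul h);
  counit1 : counit 1 = 1;
  counitM : forall g h, counit (g * h) = counit g * counit h;
  antipodel : forall h,
    tlift (fun x y => antipode x * y) (comul h) = counit h *: 1;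
  antipoder : forall h,
    tlift (fun x y => x * antipode y) (comul h) = counit h *: 1
}.

#[short(type="hopfType")]
HB.structure Definition Hopf (F : fieldType) := {H of Falgebra F H & isHopf F H}.

(* Sweedler notation: [sweedler h (fun h1 h2 => E)] is the sum written
   \sum E(h_(1), h_(2)), for E bilinear. *)
Definition sweedler (F : fieldType) (H : hopfType F) (W : lmodType F) (h : H)
    (E : H -> H -> W) : W :=
  tlift E (comul h).

Definition grouplike (F : fieldType) (H : hopfType F) : pred H :=
  fun g => (comul g == tens g g) && (counit g == 1).

Section GroupLike.
Variables (F : fieldType) (H : hopfType F).

Record grouplikes := GroupLike { glval :> H; _ : grouplike glval }.

HB.instance Definition _ := [isSub for glval].
HB.instance Definition _ := [Choice of grouplikes by <:].

Lemma tmul_tens (a b c d : H) :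
  tmul (tens a b) (tens c d) = tens (a * c) (b * d).
Proof.
have bb (x y : H) : bilin (fun c d : H => tens (x * c) (y * d)).
  split=> [u k s t|v k s t] /=; rewrite mulrDr -scalerAr.
    exact: (tens_bilin _ _).1.
  exact: (tens_bilin _ _).2.
rewrite /tmul tlift_tens ?tlift_tens //.
split=> [u k s t|v k s t] /=; rewrite {1}/tlift scaler_sumr -big_split /=;
  apply: eq_bigr => i _; rewrite scaler_sumr -big_split /=;
  apply: eq_bigr => j _; rewrite mulrDl -scalerAl.
  by rewrite (tens_bilin _ _).1 scalerDr !scalerA mulrC.
by rewrite (tens_bilin _ _).2 scalerDr !scalerA mulrC.
Qed.

Lemma tmul_bilin : bilin (@tmul F H).
Proof.
split=> [u k s t|v k s t]; last exact: linearP.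
rewrite /tmul {1}/tlift scaler_sumr -big_split /=; apply: eq_bigr => i _.
rewrite scaler_sumr -big_split /=; apply: eq_bigr => j _.
by rewrite linearP scalerDr !scalerA mulrC.
Qed.

Lemma tmul_tensA (s : tensor H H) (a b c d : H) :
  tmul s (tmul (tens a b) (tens c d)) = tmul (tmul s (tens a b)) (tens c d).
Proof.
pose m t := HB.pack_for {linear tensor H H -> tensor H H} (@tmul F H ^~ t)
  (GRing.isLinear.Build F _ _ _ (@tmul F H ^~ t) (tmul_bilin.2 t)).
pose f := m (tmul (tens a b) (tens c d)).
pose g : {linear tensor H H -> tensor H H} := m (tens c d) \o m (tens a b).
have fg u v : f (tens u v) = g (tens u v) by rewrite /= !tmul_tens !mulrA.
by rewrite -[LHS]/(f s) (tlift_uniq fg) -(@tlift_uniq _ _ _ _ _ g).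
Qed.

Lemma tmul1 (s : tensor H H) : tmul s (tens 1 1) = s.
Proof.
rewrite [RHS]tens_basis; apply: eq_bigr => i _; apply: eq_bigr => j _.
rewrite tlift_tens ?mulr1 //.
split=> [u k p q|v k p q] /=; rewrite mulrDr -scalerAr.
  exact: (tens_bilin _ _).1.
exact: (tens_bilin _ _).2.
Qed.

Lemma grouplikeP (g : H) :
  reflect (comul g = tens g g /\ counit g = 1) (grouplike g).
Proof. by apply: (iffP andP) => [[/eqP-> /eqP->]|[-> ->]]. Qed.

Lemma grouplike1 : grouplike (1 : H).
Proof. by apply/grouplikeP; rewrite comul1 counit1. Qed.

Lemma grouplikeM (g h : H) : grouplike g -> grouplike h -> grouplike (g * h).
Proof.
move=> /grouplikeP[cg eg] /grouplikeP[ch eh]; apply/grouplikeP.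
by rewrite comulM counitM cg ch eg eh tmul_tens mulr1.
Qed.

Lemma antipode_bilin :
  bilin (fun x y : H => antipode x * y) /\ bilin (fun x y : H => x * antipode y).
Proof.
split; split=> [u k s t|v k s t] /=; rewrite ?antipode_is_linear.
- by rewrite mulrDr scalerAr.
- by rewrite mulrDl scalerAl.
- by rewrite mulrDr scalerAr.
- by rewrite mulrDl scalerAl.
Qed.

Lemma grouplike_antipode (g : H) : grouplike g ->
  antipode g * g = 1 /\ g * antipode g = 1.
Proof.
move=> /grouplikeP[cg eg]; have [bl br] := antipode_bilin.
have := antipodel g; have := antipoder g.
by rewrite cg eg scale1r !tlift_tens.
Qed.

Lemma grouplike_unit (g : H) : grouplike g -> g \is a GRing.unit.
Proof. by move=> /grouplike_antipode[sg gs]; apply/unitrP; exists (antipode g). Qed.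

Lemma grouplikeV (g : H) : grouplike g -> grouplike g^-1.
Proof.
move=> gg; have ug := grouplike_unit gg.
have /grouplikeP[cg eg] := gg; apply/grouplikeP; split; last first.
  by rewrite -[LHS]mulr1 -eg -counitM mulVr // counit1.
rewrite -[LHS]tmul1 -(mulrV ug) -tmul_tens tmul_tensA.
by rewrite -cg -comulM mulVr // comul1 tmul_tens !mul1r.
Qed.

Let gl1 := GroupLike grouplike1.
Let glM (g h : grouplikes) := GroupLike (grouplikeM (valP g) (valP h)).
Let glV (g : grouplikes) := GroupLike (grouplikeV (valP g)).

Fact glMA : associative glM.
Proof. by move=> x y z; apply: val_inj; rewrite /= mulrA. Qed.
Fact gl1M : left_id gl1 glM.
Proof. by move=> x; apply: val_inj; rewrite /= mul1r. Qed.
Fact glM1 : right_id gl1 glM.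
Proof. by move=> x; apply: val_inj; rewrite /= mulr1. Qed.
Fact glVM : left_inverse gl1 glV glM.
Proof.
by move=> x; apply: val_inj; rewrite /= mulVr // (grouplike_unit (valP x)).
Qed.
Fact glMV : right_inverse gl1 glV glM.
Proof.
by move=> x; apply: val_inj; rewrite /= mulrV // (grouplike_unit (valP x)).
Qed.

HB.instance Definition _ := isGroup.Build grouplikes glMA gl1M glM1 glVM glMV.

End GroupLike.

Arguments grouplikes {F} H.

Section FieldUnits.
Variable F : fieldType.

Record funits := FUnit { fuval :> F; _ : fuval != 0 }.

HB.instance Definition _ := [isSub for fuval].
HB.instance Definition _ := [Choice of funits by <:].

Let fu1 := FUnit (oner_neq0 F).
Let fuM (x y : funits) := FUnit (mulf_neq0 (valP x) (valP y)).
Fact fuV_subproof (x : funits) : (x : F)^-1 != 0.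
Proof. by rewrite invr_eq0 (valP x). Qed.
Let fuV (x : funits) := FUnit (fuV_subproof x).

Fact fuMA : associative fuM.
Proof. by move=> x y z; apply: val_inj; rewrite /= mulrA. Qed.
Fact fu1M : left_id fu1 fuM.
Proof. by move=> x; apply: val_inj; rewrite /= mul1r. Qed.
Fact fuM1 : right_id fu1 fuM.
Proof. by move=> x; apply: val_inj; rewrite /= mulr1. Qed.
Fact fuVM : left_inverse fu1 fuV fuM.
Proof. by move=> x; apply: val_inj; rewrite /= mulVf // (valP x). Qed.
Fact fuMV : right_inverse fu1 fuV fuM.
Proof. by move=> x; apply: val_inj; rewrite /= mulfV // (valP x). Qed.

HB.instance Definition _ := isGroup.Build funits fuMA fu1M fuM1 fuVM fuMV.

Lemma fumulC : commutative (fun x y : funits => (x * y)%g).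
Proof. by move=> x y; apply: val_inj; rewrite /= mulrC. Qed.

End FieldUnits.

Section Dual.
Variables (F : fieldType) (G : groupType).

Record dual := Dual { dualval :> UMagmaMorphism.type G (funits F) }.

HB.instance Definition _ := gen_eqMixin dual.
HB.instance Definition _ := gen_choiceMixin dual.

Lemma dualP (phi psi : dual) : phi =1 psi -> phi = psi.
Proof.
case: phi psi => [[f [[fM] [f1]]]] [[g [[gM] [g1]]]] /= /funext fg.
move: fM f1; rewrite {}fg => fM f1.
by rewrite (Prop_irrelevance fM gM) (Prop_irrelevance f1 g1).
Qed.

Fact dualM_subproof (phi psi : dual) :
  monoid.monoid_morphism (fun g : G => phi g * psi g)%g.
Proof.
split=> [|x y]; first by rewrite !gmulf1 mulg1.
rewrite !gmulfM -!mulgA; congr (_ * _)%g.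
by rewrite !mulgA; congr (_ * _)%g; rewrite fumulC.
Qed.
Fact dualV_subproof (phi : dual) :
  monoid.monoid_morphism (fun g : G => (phi g)^-1)%g.
Proof.
by split=> [|x y]; rewrite ?gmulf1 ?invg1 // gmulfM invgM fumulC.
Qed.

Let dual1 : dual := Dual (@one_fun G (funits F)).
Let dualM (phi psi : dual) : dual :=
  Dual (HB.pack_for (UMagmaMorphism.type G (funits F))
    (fun g : G => phi g * psi g)%g
    (isUMagmaMorphism.Build G (funits F) _ (dualM_subproof phi psi))).
Let dualV (phi : dual) : dual :=
  Dual (HB.pack_for (UMagmaMorphism.type G (funits F))
    (fun g : G => (phi g)^-1)%g
    (isUMagmaMorphism.Build G (funits F) _ (dualV_subproof phi))).

Fact dualMA : associative dualM.
Proof. by move=> x y z; apply: dualP => g /=; rewrite mulgA. Qed.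
Fact dual1M : left_id dual1 dualM.
Proof. by move=> x; apply: dualP => g /=; rewrite mul1g. Qed.
Fact dualM1 : right_id dual1 dualM.
Proof. by move=> x; apply: dualP => g /=; rewrite mulg1. Qed.
Fact dualVM : left_inverse dual1 dualV dualM.
Proof. by move=> x; apply: dualP => g /=; rewrite mulVg. Qed.
Fact dualMV : right_inverse dual1 dualV dualM.
Proof. by move=> x; apply: dualP => g /=; rewrite mulgV. Qed.

HB.instance Definition _ := isGroup.Build dual dualMA dual1M dualM1 dualVM dualMV.

Lemma dual1E (g : G) : (1%g : dual) g = 1%g.
Proof. by []. Qed.
Lemma dualME (phi psi : dual) (g : G) : (phi * psi)%g g = (phi g * psi g)%g.
Proof. by []. Qed.

End Dual.

Definition subgroup_gen (G : groupType) (S : set G) : set G :=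
  smallest (fun P : set G => group_closed (mem P)) S.

(* The family V of subsets is a grading of the algebra A by the group X: each
   V p is a subspace, A is the internal direct sum of the V p, and
   V p * V q is contained in V (p q).  Note that [\sum_(p \in [set: X]) c p]
   is the sum over the support of c when that support is finite. *)
Definition is_grading (F : fieldType) (A : algType F) (X : groupType)
    (V : X -> set A) : Prop :=
  [/\ forall p, V p 0 /\ forall (k : F) a b, V p a -> V p b -> V p (k *: a + b),
      forall a, exists! c : X -> A,
        [/\ finite_set [set p | c p != 0],
            forall p, V p (c p) &
            a = \sum_(p \in [set: X]) c p] &
      forall p q a b, V p a -> V q b -> V (p * q)%g (a * b)].

Definition grading_supp (F : fieldType) (A : algType F) (X : groupType)
    (V : X -> set A) : set X :=
  [set p | V p != [set 0]].

Record is_action (F : fieldType) (H : hopfType F) (A : algType F)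
    (act : H -> A -> A) : Prop := IsAction {
  act_linearl : forall a, linear (act^~ a);
  act_linearr : forall h, linear (act h);
  act1 : forall a, act 1 a = a;
  actM : forall g h a, act (g * h) a = act g (act h a);
  act_unit : forall h, act h 1 = counit h *: 1;
  act_mul : forall h a b,
    act h (a * b) = sweedler h (fun h1 h2 => act h1 a * act h2 b)
}.

Section Action.
Variables (F : fieldType) (H : hopfType F) (A : algType F).
Variable act : H -> A -> A.
Local Notation G := (grouplikes H).

Definition weight_space (phi : dual F G) : set A :=
  [set a | forall g : G, act g a = (phi g : F) *: a].

Definition action_ker : set G := [set g : G | forall a, act g a = a].

Definition acts_trivially (x : H) : Prop := forall a, act x a = 0.

End Action.

Definition annihilator (F : fieldType) (G : groupType) (K : set G) :
    set (dual F G) :=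
  [set phi | forall k, K k -> phi k = 1%g].

Arguments annihilator F {G} K.

(* Main.v *)
Require Import Defs.
From HB Require Import structures.
From mathcomp Require Import all_boot all_algebra all_field.
From mathcomp Require Import finmap all_classical.

Set Implicit Arguments.
Unset Strict Implicit.

Import GRing.Theory.
Local Open Scope classical_set_scope.
Local Open Scope card_scope.
Local Open Scope ring_scope.

(* Grouplike elements are linearly independent, so [G] is finite; together with
   [|dual G| = |G|] and Dedekind's independence of characters, the character
   table of [G] is an invertible square matrix.  Its inverse expresses the
   projections of [A] onto its weight spaces as combinations of the actions of
   the [g] in [G], with no assumption on the characteristic of [F].  Since [x]
   shifts weights by [chi], it kills any component whose weight [gamma] and
   shifted weight [chi * gamma] are not both in the support. *)

(** * Linear independence and finiteness of the group-likes *)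

(* If [g = \sum_j c_j s_j], applying [coord s i (x) id] to [comul g] gives
   [c_i g = c_i s_i]; some [c_i] is nonzero, so [g = s_i]. *)
Lemma grouplike_span (F : fieldType) (H : hopfType F) (s : seq H) (g : H) :
  free s -> {in s, forall h, grouplike h} -> grouplike g ->
  g \in <<s>>%VS -> g \in s.
Proof.
move=> fs gs /grouplikeP[cg eg] /(@coord_span _ _ _ (in_tuple s)) gE.
pose f i (u v : H) := coord (in_tuple s) i u *: v.
have fb i : bilin (f i).
  split=> [u k a b|v k a b]; rewrite /f /=.
    by rewrite scalerDr !scalerA mulrC.
  by rewrite linearP scalerDl scalerA.
have fE i : f i g g = coord (in_tuple s) i g *: (in_tuple s)`_i.
  have := tlift_tens (fb i) g g; rewrite -cg => <-.
  pose phi : {linear H -> tensor H H} := HB.pack (@comul F H)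
    (GRing.isLinear.Build F H (tensor H H) _ _ (@comul_is_linear F H)).
  rewrite {1}gE -[comul _]/(phi _) !linear_sum (bigD1 i) // big1.
    have /gs/grouplikeP[ci _] : s`_i \in s by apply: mem_nth.
    rewrite !linearZ /= addr0 ci (tlift_tens (fb i)) /f coord_free //.
    by rewrite eqxx scale1r.
  move=> j ji; have /gs/grouplikeP[cj _] : s`_j \in s by apply: mem_nth.
  rewrite !linearZ /= cj (tlift_tens (fb i)) /f coord_free //.
  by move: ji; rewrite -val_eqE eq_sym /= => /negPf ->; rewrite scale0r scaler0.
(* If every coordinate vanished, [g] would be 0, against [counit g = 1]. *)
have [i ci0] : exists i, coord (in_tuple s) i g != 0.
  apply: contrapT => /forallNP c0; move: (oner_neq0 F); rewrite -eg gE big1.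
    pose e : {scalar H} := HB.pack (@counit F H)
      (GRing.isLinear.Build F H F _ _ (@counit_is_scalar F H)).
    by rewrite (linear0 e : counit 0 = 0) eqxx.
  by move=> i _; have /negP/negPn/eqP-> := c0 i; rewrite scale0r.
by rewrite (scalerI ci0 (fE i)) mem_nth.
Qed.

(** By induction: a head lying in the span of the free tail would already be a member of the tail,
    which [uniq] forbids. *)
Lemma grouplike_free (F : fieldType) (H : hopfType F) (s : seq H) :
  uniq s -> {in s, forall h, grouplike h} -> free s.
Proof.
elim: s => [|g s IH] /=; first by rewrite nil_free.
move=> /andP[gs us] gls; rewrite free_cons.
have gls' : {in s, forall h, grouplike h}.
  by move=> h hs; apply: gls; rewrite inE hs orbT.
have fs := IH us gls'; rewrite fs andbT; apply: contra gs => gs.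
have gg := gls g (mem_head _ _).
exact: (grouplike_span fs gls' gg gs).
Qed.

Lemma finite_grouplikes (F : fieldType) (H : hopfType F) :
  finite_set [set: grouplikes H].
Proof.
apply: contrapT => /(infinite_set_fset (\dim {:H}).+1)[B _].
have /eqP sB : free (map val (enum_fset B)).
  apply: grouplike_free; first by rewrite (map_inj_uniq val_inj) fset_uniq.
  by move=> _ /mapP[g _ ->]; exact: valP.
by rewrite -[size _](size_map val) -sB ltnNge dimvS ?subvf.
Qed.

(** * Independence of characters and the inverse character table *)

(** Dedekind's argument: evaluate the relation at [h * g] and subtract [psi h] times the relation at
    [g]. The [psi] term cancels, leaving a shorter relation with coefficients
    [c phi * (phi h - psi h)], where [h] is chosen to separate [phi] from [psi]. *)
Lemma dual_lin_indep (F : fieldType) (G : groupType) (s : seq (dual F G))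
    (c : dual F G -> F) :
  uniq s -> (forall g, \sum_(phi <- s) c phi * (phi g : F) = 0) ->
  {in s, forall phi, c phi = 0}.
Proof.
elim: s c => [//|psi s IH] c /= /andP[psis us] c0.
have cs : {in s, forall phi, c phi = 0}.
  move=> phi phis.
  have [h hP] : exists h, (phi h : F) != (psi h : F).
    apply: contrapT => /forallNP E; move: psis; rewrite (_ : psi = phi) ?phis //.
    by apply: dualP => h; apply: val_inj; have /negP/negPn/eqP := E h.
  have /eqP : c phi * ((phi h : F) - (psi h : F)) = 0.
    apply: (IH (fun q => c q * ((q h : F) - (psi h : F))) us _ phi phis) => g.
    have E0 : \sum_(q <- psi :: s)
        (c q * (q (h * g)%g : F) - (psi h : F) * (c q * (q g : F))) = 0.
      by rewrite sumrB -mulr_sumr !c0 mulr0 subr0.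
    rewrite -[RHS]E0 big_cons gmulfM /= mulrCA subrr add0r.
    apply: eq_bigr => q _.
    by rewrite gmulfM /= -mulrA mulrBl mulrBr (mulrCA (psi h : F)).
  by rewrite mulf_eq0 subr_eq0 (negPf hP) orbF => /eqP.
move=> phi; rewrite inE => /orP[/eqP->|/cs//].
(* Only the [psi] term survives, and [psi 1 = 1]. *)
have := c0 1%g; rewrite big_cons big1_seq => [|q /= /cs ->].
  by rewrite gmulf1 addr0 mulr1.
by rewrite mul0r.
Qed.

(** The two identities are the row and column orthogonality relations, with [Y] in place of the
    usual inverse characters divided by the order of [G], so that this order may vanish in [F]. *)
Lemma dual_matrix_inv (F : fieldType) (G : groupType) :
  finite_set [set: G] -> [set: dual F G] #= [set: G] ->
  exists Y : G -> dual F G -> F,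
    (forall phi psi : dual F G,
          \sum_(g \in [set: G]) Y g phi * (psi g : F) = (psi == phi)%:R)
    /\ (forall g h : G,
          \sum_(phi \in [set: dual F G]) Y g phi * (phi h : F) = (g == h)%:R).
Proof.
move=> fG card.
have fD : finite_set [set: dual F G] by rewrite (eq_finite_set card).
pose sG : seq G := fset_set [set: G].
pose sD : seq (dual F G) := fset_set [set: dual F G].
have sz : size sD = size sG by exact/fcard_eq.
have inG g : g \in sG by rewrite in_fset_set // in_setT.
have inD phi : phi \in sD by rewrite in_fset_set // in_setT.
have uG : uniq sG := fset_uniq _; have uD : uniq sD := fset_uniq _.
pose M : 'M[F]_(size sD, size sG) :=
  \matrix_(i, j) (tnth (in_tuple sD) i (tnth (in_tuple sG) j) : F).
pose iG g : 'I_(size sG) := Ordinal (etrans (index_mem g sG) (inG g)).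
pose iD g : 'I_(size sD) := Ordinal (etrans (index_mem g sD) (inD g)).
have iGK g : tnth (in_tuple sG) (iG g) = g by rewrite (tnth_nth 1%g) nth_index.
have iDK g : tnth (in_tuple sD) (iD g) = g by rewrite (tnth_nth 1%g) nth_index.
have tGK : cancel (tnth (in_tuple sG)) iG.
  by move=> i; apply: val_inj; rewrite (tnth_nth 1%g) /= index_uniq.
have tDK : cancel (tnth (in_tuple sD)) iD.
  by move=> i; apply: val_inj; rewrite (tnth_nth 1%g) /= index_uniq.
(* A row vector killed by [M] is a linear relation among the characters. *)
have Mfree : row_free M.
  apply: inj_row_free => v vM; apply/rowP => i; rewrite mxE -[i]tDK.
  apply: (dual_lin_indep (c := fun phi => v 0 (iD phi)) uD _ (inD _)) => g.
  have := congr1 (fun w : 'rV_(size sG) => w 0 (iG g)) vM.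
  rewrite !mxE => E; rewrite -[RHS]E big_tnth; apply: eq_bigr => j _.
  by rewrite tDK mxE iGK.
(* The rank [size sD] equals [size sG] by [sz], so [pinvmx M] is a two-sided inverse. *)
have Mfull : row_full M by move: Mfree => /eqP rM; apply/eqP; rewrite rM.
exists (fun g phi => pinvmx M (iG g) (iD phi)); split=> [phi psi|g h].
  have /matrixP/(_ (iD psi) (iD phi)) := mulmxVp Mfree.
  rewrite !mxE (can_eq iDK) => E; rewrite -[RHS]E fsbig_finite // big_tnth.
  by apply: eq_bigr => j _; rewrite tGK !mxE iDK mulrC.
have /matrixP/(_ (iG g) (iG h)) := mulVpmx Mfull.
rewrite !mxE (can_eq iGK) => E; rewrite -[RHS]E fsbig_finite // big_tnth.
by apply: eq_bigr => j _; rewrite tDK !mxE iGK.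
Qed.

(** * The weight grading of [A] *)

Section ActionTheory.
Variables (F : fieldType) (H : hopfType F) (A : algType F) (act : H -> A -> A).
Hypothesis actP : is_action act.
Local Notation G := (grouplikes H).

Let rho (h : H) : {linear A -> A} := HB.pack (act h)
  (GRing.isLinear.Build F A A _ _ (act_linearr actP h)).

Lemma actZl (k : F) (h : H) (a : A) : act (k *: h) a = k *: act h a.
Proof.
pose f : {linear H -> A} := HB.pack (act^~ a)
  (GRing.isLinear.Build F H A _ _ (act_linearl actP a)).
by rewrite -[LHS]/(f _) linearZ.
Qed.

Lemma actZr (h : H) (k : F) (a : A) : act h (k *: a) = k *: act h a.
Proof. by rewrite -[LHS]/(rho h _) linearZ. Qed.

Lemma act0 (h : H) : act h 0 = 0.
Proof. exact: (linear0 (rho h)). Qed.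

Lemma act_sum (I : Type) (r : seq I) (h : H) (f : I -> A) :
  act h (\sum_(i <- r) f i) = \sum_(i <- r) act h (f i).
Proof. exact: (linear_sum (rho h)). Qed.

Lemma grouplike_actM (g : G) (a b : A) : act g (a * b) = act g a * act g b.
Proof.
have /grouplikeP[cg _] := valP g.
rewrite (act_mul actP) /sweedler cg tlift_tens //.
split=> [u k s t|v k s t] /=.
  by rewrite (act_linearl actP) mulrDr scalerAr.
by rewrite (act_linearl actP) mulrDl scalerAl.
Qed.

Lemma weight_space_lin (phi : dual F G) : weight_space act phi 0 /\
  forall (k : F) a b, weight_space act phi a -> weight_space act phi b ->
    weight_space act phi (k *: a + b).
Proof.
split=> [g|k a b aP bP g]; first by rewrite act0 scaler0.
by rewrite (act_linearr actP) aP bP scalerDr !scalerA mulrC.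
Qed.

Lemma weight_spaceM (phi psi : dual F G) (a b : A) :
  weight_space act phi a -> weight_space act psi b ->
  weight_space act (phi * psi)%g (a * b).
Proof.
by move=> aP bP g; rewrite grouplike_actM aP bP -scalerAl -scalerAr scalerA.
Qed.

Lemma grading_suppP (phi : dual F G) (a : A) :
  weight_space act phi a -> a != 0 -> grading_supp (weight_space act) phi.
Proof.
move=> aP; apply: contra => /eqP E; move: aP; rewrite E /= => ->.
by rewrite eqxx.
Qed.

(* The component of [a] of weight [phi] is [\sum_g Y g phi *: act g a], with
   [Y] the inverse of the character table. *)
Lemma weight_space_grading :
  [set: dual F G] #= [set: G] -> is_grading (weight_space act).
Proof.
move=> card; have fG := finite_grouplikes H.
have fD : finite_set [set: dual F G] by rewrite (eq_finite_set card).
have [Y [orth1 orth2]] := dual_matrix_inv fG card.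
have sumD (V : nmodType) (f : dual F G -> V) :
  \sum_(phi \in [set: dual F G]) f phi
  = \sum_(phi <- fset_set [set: dual F G]) f phi by rewrite fsbig_finite.
have sumG (V : nmodType) (f : G -> V) :
  \sum_(g \in [set: G]) f g = \sum_(g <- fset_set [set: G]) f g.
  by rewrite fsbig_finite.
have delta (f : dual F G -> A) psi :
    \sum_(phi \in [set: dual F G]) (phi == psi)%:R *: f phi = f psi.
  rewrite sumD (big_fsetD1 psi) /=; last by rewrite in_fset_set // in_setT.
  rewrite eqxx scale1r big_seq big1 ?addr0 // => phi.
  by rewrite in_fsetD1 => /andP[/negPf-> _]; rewrite scale0r.
have deltaG (f : G -> A) h :
    \sum_(g \in [set: G]) (g == h)%:R *: f g = f h.
  rewrite sumG (big_fsetD1 h) /=; last by rewrite in_fset_set // in_setT.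
  rewrite eqxx scale1r big_seq big1 ?addr0 // => g.
  by rewrite in_fsetD1 => /andP[/negPf-> _]; rewrite scale0r.
pose c a phi := \sum_(g \in [set: G]) Y g phi *: act g a.
(* Fourier inversion, from [orth2]; at [h = 1] it writes [a] as the sum of its components. *)
have cE h a :
    act (h : G) a = \sum_(phi \in [set: dual F G]) (phi h : F) *: c a phi.
  rewrite sumD -(deltaG (fun g => act g a)) /c.
  under [RHS]eq_bigr do rewrite sumG scaler_sumr.
  rewrite exchange_big /= sumG; apply: eq_bigr => g _.
  rewrite -orth2 sumD scaler_suml; apply: eq_bigr => phi _.
  by rewrite scalerA mulrC.
(* Expand each [act (g * h) a] by [cE]; summing over [h] with [orth1] leaves only the term
   [psi = phi]. *)
have cV a phi : weight_space act phi (c a phi).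
  move=> g; rewrite -[RHS](delta (fun psi => (psi g : F) *: c a psi)) {1}/c.
  rewrite sumG act_sum.
  under eq_bigr do rewrite actZr -(actM actP) -[_ * _]/(glval (g * _)%g) cE sumD.
  under eq_bigr do rewrite scaler_sumr.
  rewrite exchange_big /= sumD; apply: eq_bigr => psi _.
  rewrite -orth1 sumG scaler_suml; apply: eq_bigr => h _.
  by rewrite !scalerA gmulfM /= mulrCA mulrC.
(* Uniqueness: by [orth1], the projection to weight [psi] keeps just [d psi] from any sum of weight
   vectors. *)
have cK a d : (forall phi, weight_space act phi (d phi)) ->
    a = \sum_(phi \in [set: dual F G]) d phi -> c a = d.
  move=> dV ->; apply/funext => psi; rewrite -[RHS](delta d) /c !sumD sumG.
  under eq_bigr do rewrite act_sum scaler_sumr.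
  rewrite exchange_big /=; apply: eq_bigr => phi _.
  rewrite -orth1 sumG scaler_suml; apply: eq_bigr => g _.
  by rewrite dV scalerA.
split; [exact: weight_space_lin | | exact: weight_spaceM].
move=> a; exists (c a); split; last by move=> d [_ dV aE]; exact: cK.
split; [exact: sub_finite_set fD | exact: cV |].
rewrite -[LHS](act1 actP) -[1]/(glval (1 : G)%g) cE !sumD.
by apply: eq_bigr => phi _; rewrite gmulf1 scale1r.
Qed.

(** * Weight shift by [x] and criteria for trivial action *)

Variables (x : H) (chi : dual F G).
Hypothesis xP : forall h : G, (h : H) * x = (chi h : F) *: (x * (h : H)).

Lemma act_twisted (h : G) (a : A) :
  act h (act x a) = (chi h : F) *: act x (act h a).
Proof. by rewrite -!(actM actP) xP actZl. Qed.

Lemma weight_space_act (gamma : dual F G) (a : A) :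
  weight_space act gamma a -> weight_space act (chi * gamma)%g (act x a).
Proof. by move=> aP g; rewrite act_twisted aP actZr scalerA. Qed.

(** For [k] in the kernel, [act_twisted] reads [act x a = chi k *: act x a], so one nonzero
    [act x a] forces [chi k = 1]. *)
Lemma acts_trivially_kerN :
  ~ annihilator F (action_ker act) chi -> acts_trivially act x.
Proof.
move=> chiN a; apply/eqP; apply: contra_notT chiN => xa0 k kK.
apply: val_inj => /=; have /eqP := act_twisted k a.
rewrite !kK -[X in X == _]scale1r -subr_eq0 -scalerBl scaler_eq0 (negPf xa0).
by rewrite orbF subr_eq0 => /eqP <-.
Qed.

(** Common criterion behind (iii) and (iv), checked on each homogeneous component. *)
Lemma acts_trivially_supp :
  is_grading (weight_space act) ->
  (forall gamma, grading_supp (weight_space act) gamma ->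
    ~ grading_supp (weight_space act) (chi * gamma)%g) ->
  acts_trivially act x.
Proof.
move=> [_ gr _] suppN a; have [c [[fc cV ->] _]] := gr a.
rewrite (fsbigTE (fset_set [set p | c p != 0])); last first.
  by move=> p; rewrite in_fset_set // notin_setE /= => /negP/negPn/eqP.
rewrite act_sum big1 // => p _; apply/eqP/negPn/negP => xc0.
have cp0 : c p != 0 by apply: contra xc0 => /eqP ->; rewrite act0.
apply: (suppN p); first exact: grading_suppP cp0.
exact: (grading_suppP (weight_space_act (cV p))).
Qed.

End ActionTheory.

Theorem proposition3p1 (F : fieldType) (H : hopfType F) (A : algType F)
    (act : H -> A -> A) (x : H) (chi : dual F (grouplikes H)) :
  (forall g h : grouplikes H, (g * h = h * g)%g) ->
  [set: dual F (grouplikes H)] #= [set: grouplikes H] ->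
  is_action act ->
  (forall h : grouplikes H, (h : H) * x = (chi h : F) *: (x * (h : H))) ->
  let Gamma := weight_space act in
  let Supp := grading_supp Gamma in
  let K := action_ker act in
  let Kperp := annihilator F K in
  let T := subgroup_gen Supp in
  [/\ (* Gamma is a grading *)
      is_grading Gamma,
      (* (i) *)
      forall (gamma : dual F (grouplikes H)) (a : A),
        Gamma gamma a -> Gamma (chi * gamma)%g (act x a),
      (* (ii) *)
      ~ Kperp chi -> acts_trivially act x,
      (* (iii) *)
      ~ T chi -> acts_trivially act x &
      (* (iv) *)
      (exists m : nat,
         (forall phi, Supp phi -> (phi ^+ m = 1)%g) /\ (chi ^+ m <> 1)%g) ->
      acts_trivially act x].
Proof.
move=> _ card actP xP Gamma Supp K Kperp T.
have gr : is_grading Gamma := weight_space_grading actP card.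
split=> //.
- exact: weight_space_act.
- exact: acts_trivially_kerN.
- move=> chiT; apply: (acts_trivially_supp actP xP gr) => gamma sg scg.
  (* [chi] is the quotient of [chi * gamma] by [gamma], both in the support, and [P] is closed under
     quotients. *)
  apply: chiT => P [[_ PV] SP].
  have := PV _ _ (mem_set (SP _ scg)) (mem_set (SP _ sg)).
  by rewrite mulgK => /set_mem.
- move=> [m [suppX chiX]].
  apply: (acts_trivially_supp actP xP gr) => gamma sg scg; apply: chiX.
  (* Commutation gives [(chi * gamma) ^+ m = chi ^+ m * gamma ^+ m], where both the left side and
     [gamma ^+ m] are 1. *)
  have com : (chi * gamma = gamma * chi)%g.
    by apply: dualP => g; rewrite !dualME fumulC.
  by have := suppX _ scg; rewrite expgMn // (suppX _ sg) mulg1.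
Qed.
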